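(* Let $X$ be an $s$-indefinite-distance set in $\mathbb{R}^{p,q}$. If $0\notin A(X)$, then \[ |X|\le \binom{p+q+s}{s}. \]
   Context: $\mathbb{R}^{p,q}$ is the real vector space $\mathbb{R}^{p+q}$ with the bilinear form $\langle\langle x,y\rangle\rangle=x_1y_1+\cdots+x_py_p-x_{p+1}y_{p+1}-\cdots-x_{p+q}y_{p+q}$, and $\|x\|:=\langle\langle x,x\rangle\rangle$ (no square root; it can be zero or negative). For a finite subset $X\subset\mathbb{R}^{p,q}$, $A(X)=\{\|x-y\| : x,y\in X,\ x\neq y\}$. A finite subset $X$ of $\mathbb{R}^{p,q}$ is an $s$-indefinite-distance set if $|A(X)|=s$. *)

(* Defs.v *)
From HB Require Import structures.
From mathcomp Require Import all_boot all_order all_algebra.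
From mathcomp Require Import finmap reals.

Set Implicit Arguments.
Unset Strict Implicit.
Unset Printing Implicit Defensive.

Import Order.TTheory GRing.Theory Num.Theory.
Local Open Scope ring_scope.
Local Open Scope fset_scope.

(* The space R^{p,q} is 'rV[R]_(p + q) with [indef_form]; lshift and rshift
   are the inclusions of the first p and of the last q coordinates. *)
Definition indef_form (R : realType) (p q : nat) (x y : 'rV[R]_(p + q)) : R :=
  \sum_(i < p) x 0 (lshift q i) * y 0 (lshift q i)
  - \sum_(j < q) x 0 (rshift p j) * y 0 (rshift p j).

(* No square root: this may vanish or be negative for a nonzero x. *)
Definition indef_norm (R : realType) (p q : nat) (x : 'rV[R]_(p + q)) : R :=
  indef_form x x.

Definition indef_distances (R : realType) (p q : nat)
    (X : {fset 'rV[R]_(p + q)}) : {fset R} :=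
  [fset indef_norm (x - y) | x in X, y in X & x != y].

Definition indefinite_distance_set (R : realType) (p q s : nat)
    (X : {fset 'rV[R]_(p + q)}) : Prop :=
  #|` indef_distances X| = s.

(* Main.v *)
Require Import Defs.
From HB Require Import structures.
From mathcomp Require Import all_boot all_order all_algebra.
From mathcomp Require Import finmap reals.
From mathcomp Require Import mpoly.

Set Implicit Arguments.
Unset Strict Implicit.
Unset Printing Implicit Defensive.

Import Order.TTheory GRing.Theory Num.Theory.
Local Open Scope ring_scope.
Local Open Scope fset_scope.

(** The argument is the sign-of-a-quadratic-form method of Petrov and Pohoata,
    which rests on the Croot-Lev-Pach observation about polynomials of low
    degree in two groups of variables.

    Put d = p + q, let D be the set of the s distances, and consider the kernel
    P(x, y) = \prod_(a in D) (||x - y|| - a), a polynomial of degree at most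
    2s in the 2d coordinates of x and y.  On X x X it vanishes off the diagonal,
    and its diagonal value is the constant c = \prod_(a in D) (- a), which is
    nonzero exactly because 0 is not a distance.  So for every weight f on X,
      \sum_(x, y) f x * f y * P(x, y) = c * \sum_x f x ^+ 2.
    Suppose now that all the moments \sum_x f x * x^m with |m| <= s vanish.
    Each monomial of P has the form x^m * y^m' with |m| + |m'| <= 2s, so that
    |m| <= s or |m'| <= s, and its contribution to the left-hand side is a
    product of two moments, one of which is zero ([quadratic_form_eq0]).  Hence
    \sum_x f x ^+ 2 = 0 and f = 0.  The linear map sending a weight to its
    moments of degree at most s is therefore injective, and |X| is at most the
    number of monomials of degree at most s in d variables, which is
    'C(d + s, s) ([card_bmultinom]).

    The form on the space is indefinite, but the quadratic form in the weights
    is definite: its matrix is c times the identity. *)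

(** A monomial is determined by its tuple of exponents, so the count reduces
    to that of the tuples with bounded sum. *)
Lemma card_bmultinom (n k : nat) : #|{: 'X_{1..n < k.+1}}| = 'C(n + k, k).
Proof.
rewrite -(bin_sub (leq_addl n k)) addnK -card_partial_ord_partitions.
pose exps (m : 'X_{1..n < k.+1}) : n.-tuple 'I_k.+1 :=
  [tuple inord (bmnm m i) | i < n].
have le_exp (m : 'X_{1..n < k.+1}) i : (bmnm m i < k.+1)%N.
  by apply: leq_ltn_trans (bmdeg m); rewrite mdegE (bigD1 i) //= leq_addr.
have exps_inj : injective exps.
  move=> m1 m2 eq_m; apply/val_inj/mnmP => i.
  have /(congr1 val) := congr1 (fun t => tnth t i) eq_m.
  by rewrite !tnth_mktuple /= !inordK.
rewrite -(card_imset _ exps_inj); apply: eq_card => t; rewrite inE.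
apply/imsetP/idP => [[m _ ->]|le_t].
  rewrite big_tuple (eq_bigr (fun i => bmnm m i)) => [|i _].
    by rewrite -mdegE -ltnS bmdeg.
  by rewrite tnth_mktuple inordK.
pose m : 'X_{1..n} := [multinom (tnth t i : nat) | i < n].
have lt_m : (mdeg m < k.+1)%N.
  rewrite mdegE ltnS; move: le_t; rewrite big_tuple.
  by congr (_ <= _)%N; apply: eq_bigr => i _; rewrite mnmE.
exists (BMultinom lt_m) => //; apply: eq_from_tnth => i.
by rewrite tnth_mktuple mnmE inord_val.
Qed.

(** Since [msize] is the degree plus one, this is the subadditivity of degrees
    under products, in a form that also covers the zero polynomial. *)
Lemma msizeM_leq (R : idomainType) (n a b : nat) (P Q : {mpoly R[n]}) :
  (msize P <= a.+1 -> msize Q <= b.+1 -> msize (P * Q) <= (a + b).+1)%N.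
Proof.
move=> leP leQ; have [->|P0] := eqVneq P 0; first by rewrite mul0r msize0.
have [->|Q0] := eqVneq Q 0; first by rewrite mulr0 msize0.
rewrite msizeM // -subn1 leq_subLR add1n -addSn -addnS.
exact: leq_add.
Qed.

Lemma mevalX_row_mx (R : comNzRingType) (n1 n2 : nat) (m : 'X_{1..n1 + n2})
    (x : 'rV[R]_n1) (y : 'rV[R]_n2) :
  \prod_i row_mx x y 0 i ^+ m i
  = 'X_[[multinom m (lshift n2 i) | i < n1]].@[x 0]
    * 'X_[[multinom m (rshift n1 j) | j < n2]].@[y 0].
Proof.
rewrite big_split_ord !mevalX /=.
by congr *%R; apply: eq_bigr => i _; rewrite ?row_mxEl ?row_mxEr mnmE.
Qed.

(** The degree of [P] is at most 2k + 1, so in each of its monomials one of the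
    two groups of variables has degree at most k; the sum over the points in
    that group is a vanishing moment. *)
Lemma quadratic_form_eq0 (R : comNzRingType) (n k : nat) (T : finType)
    (pt : T -> 'rV[R]_n) (f : T -> R) (P : {mpoly R[n + n]}) :
  (msize P <= k.*2.+2)%N ->
  (forall m : 'X_{1..n},
     (mdeg m <= k)%N -> \sum_t f t * 'X_[m].@[pt t 0] = 0) ->
  \sum_t \sum_u f t * f u * P.@[row_mx (pt t) (pt u) 0] = 0.
Proof.
move=> sizeP f_moments.
under eq_bigr => t _ do under eq_bigr => u _ do rewrite mevalE mulr_sumr.
under eq_bigr => t _ do rewrite exchange_big.
rewrite exchange_big big_seq big1 //= => m Pm.
pose ml := [multinom m (lshift n i) | i < n].
pose mr := [multinom m (rshift n j) | j < n].
have deg_m : (mdeg ml + mdeg mr = mdeg m)%N.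
  rewrite !mdegE big_split_ord /=.
  by congr addn; apply: eq_bigr => i _; rewrite mnmE.
transitivity (P@_m * ((\sum_t f t * 'X_[ml].@[pt t 0])
                      * (\sum_u f u * 'X_[mr].@[pt u 0]))).
  rewrite mulr_suml mulr_sumr; apply: eq_bigr => t _.
  rewrite mulr_sumr mulr_sumr; apply: eq_bigr => u _.
  by rewrite mevalX_row_mx -/ml -/mr mulrCA mulrACA.
have lt_deg : (mdeg ml + mdeg mr < k.*2.+2)%N.
  by rewrite deg_m; apply: leq_trans (msize_mdeg_lt Pm) sizeP.
have [le_l|lt_l] := leqP (mdeg ml) k; first by rewrite f_moments // mul0r mulr0.
have le_r : (mdeg mr <= k)%N.
  rewrite -(leq_add2l k.+1); apply: leq_trans (leq_add lt_l (leqnn _)) _.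
  by rewrite addSn addnn -ltnS.
by rewrite [X in _ * (_ * X)]f_moments // !mulr0.
Qed.

(** A polynomial kernel of degree at most 2k + 1 that restricts to a nonzero
    multiple of the identity on a family of points represents a definite form,
    while it vanishes on the weights whose moments up to degree k are all zero.
    Hence only the zero weight has this property, and the matrix of the monomials
    evaluated at the points has independent rows. *)
Lemma card_polynomial_diagonal (R : realFieldType) (n k : nat) (T : finType)
    (pt : T -> 'rV[R]_n) (P : {mpoly R[n + n]}) (c : R) :
  c != 0 -> (msize P <= k.*2.+2)%N ->
  (forall t u, P.@[row_mx (pt t) (pt u) 0] = if t == u then c else 0) ->
  (#|T| <= 'C(n + k, k))%N.
Proof.
move=> c0 sizeP diagP; rewrite -card_bmultinom.
pose E : 'M[R]_(#|T|, #|{: 'X_{1..n < k.+1}}|) :=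
  \matrix_(i, j) 'X_[bmnm (enum_val j)].@[pt (enum_val i) 0].
suff /eqP <- : row_free E by apply: rank_leq_col.
apply: inj_row_free => v vE0.
pose f t := v 0 (enum_rank t).
have f_moments (m : 'X_{1..n}) :
    (mdeg m <= k)%N -> \sum_t f t * 'X_[m].@[pt t 0] = 0.
  move=> le_m; have lt_m : (mdeg m < k.+1)%N by [].
  have /rowP/(_ (enum_rank (BMultinom lt_m))) := vE0.
  rewrite !mxE => E0; rewrite (reindex _ (onW_bij _ (enum_val_bij _))) /=.
  by rewrite -[RHS]E0; apply: eq_bigr => i _; rewrite mxE /f !enum_valK enum_rankK.
have := quadratic_form_eq0 sizeP f_moments.
have -> : \sum_t \sum_u f t * f u * P.@[row_mx (pt t) (pt u) 0]
          = c * \sum_t f t ^+ 2.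
  rewrite mulr_sumr; apply: eq_bigr => t _; rewrite (bigD1 t) //= big1 => [|u].
    by rewrite diagP eqxx addr0 mulrC expr2.
  by rewrite diagP eq_sym => /negPf ->; rewrite mulr0.
move=> /eqP; rewrite mulf_eq0 (negPf c0) /= psumr_eq0 => [/allP f0|t _].
  apply/rowP => i; rewrite mxE; apply/eqP.
  have := f0 (enum_val i) (mem_index_enum _).
  by rewrite /= sqrf_eq0 /f enum_valK.
exact: sqr_ge0.
Qed.

(** The first half of the variables stands for x and the second half for y; the
    value is then the indefinite norm of x - y. *)
Definition indef_norm_mpoly (R : realType) (p q : nat) :
    {mpoly R[(p + q) + (p + q)]} :=
  let d i := 'X_(lshift (p + q) i) - 'X_(rshift (p + q) i) in
  \sum_(i < p) d (lshift q i) * d (lshift q i)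
  - \sum_(j < q) d (rshift p j) * d (rshift p j).

Lemma meval_indef_norm_mpoly (R : realType) (p q : nat) (x y : 'rV[R]_(p + q)) :
  (indef_norm_mpoly R p q).@[row_mx x y 0] = indef_norm (x - y).
Proof.
rewrite mevalB !rmorph_sum; congr (_ - _); apply: eq_bigr => i _;
by rewrite /= mevalM !mevalB !mevalXU row_mxEl row_mxEr !mxE.
Qed.

Lemma msize_indef_norm_mpoly (R : realType) (p q : nat) :
  (msize (indef_norm_mpoly R p q) <= 3)%N.
Proof.
have leB m (P Q : {mpoly R[m]}) b :
    (msize P <= b -> msize Q <= b -> msize (P - Q) <= b)%N.
  by move=> leP leQ; rewrite (leq_trans (msizeD_le _ _)) // msizeN geq_max leP.
have le_sqr i : let d := 'X_(lshift (p + q) i) - 'X_(rshift (p + q) i)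
    : {mpoly R[_]} in (msize (d * d) <= 3)%N.
  by apply: (@msizeM_leq _ _ 1 1); apply: leB; rewrite msizeX mdeg1.
by apply: leB; apply: leq_trans (msize_sum _ _ _) _; apply/bigmax_leqP => i _.
Qed.

Theorem theorem2p2 (R : realType) (p q s : nat) (X : {fset 'rV[R]_(p + q)})
    (hX : indefinite_distance_set s X) (h0 : 0 \notin indef_distances X) :
  (#|` X| <= 'C(p + q + s, s))%N.
Proof.
pose D : seq R := indef_distances X.
pose Q := indef_norm_mpoly R p q.
pose P := \prod_(a <- D) (Q - a%:MP).
have sizeP : (msize P <= s.*2.+1)%N.
  rewrite -hX -/D /P; elim: (D) => [|a D' IH]; first by rewrite big_nil msize1.
  rewrite big_cons; apply: (@msizeM_leq _ _ 2 (size D').*2) => //.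
  rewrite (leq_trans (msizeD_le _ _)) // msizeN geq_max msize_indef_norm_mpoly.
  by rewrite msizeC; case: eqP.
have evalP x y : P.@[row_mx x y 0] = \prod_(a <- D) (indef_norm (x - y) - a).
  rewrite rmorph_prod /=; apply: eq_bigr => a _.
  by rewrite mevalB mevalC meval_indef_norm_mpoly.
rewrite cardfE.
apply: (@card_polynomial_diagonal _ _ _ _ (fun x : X => val x) P
          (\prod_(a <- D) - a)) => [||x y].
- rewrite prodf_seq_neq0; apply/allP => a Da /=; rewrite oppr_eq0.
  by apply: contraNneq h0 => <-.
- exact: leqW.
rewrite evalP; case: eqVneq => [->|xy].
  apply: eq_bigr => a _; rewrite subrr /indef_norm /indef_form.
  by rewrite !big1 ?subrr ?sub0r // => i _; rewrite mxE mul0r.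
have Dxy : indef_norm (val x - val y) \in D.
  apply/imfset2P; exists (val x); first exact: valP.
  by exists (val y) => //; rewrite inE /= (valP y) (inj_eq val_inj).
apply/eqP; rewrite prodf_seq_eq0; apply/hasP.
by exists (indef_norm (val x - val y)); rewrite ?subrr /=.
Qed.
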